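(* Let $k$ be an integer with $3\le k<200$, and let $A$ be a cyclically $k$-diagonal array of size $n>k$. Then $P(A)$ has a solution if and only if $n$ and $k$ are both odd.
   Context: Arrays are toroidal: an $n\times n$ array has rows and columns indexed modulo $n$ (representatives $1,\dots,n$). Each cell is filled or empty; $F(A)$ is the set of filled cells. For $(i,j)\in F(A)$: - the row successor $s_r((i,j))$ is $(i,j+k)$ with $k\ge1$ minimal such that $(i,j+k)\in F(A)$; - the column successor $s_c((i,j))$ is $(i+k,j)$ with $k\ge1$ minimal such that $(i+k,j)\in F(A)$. Given $R\in\{-1,1\}^n$ and $C\in\{-1,1\}^n$, the move function is $S_{R,C}((i,j))=s_c^{\,c_{j'}}((i,j'))$, where $(i,j')=s_r^{\,r_i}((i,j))$; exponent $-1$ means inverse. $R,C$ is a solution of $P(A)$ if $S_{R,C}$ is a single cycle on $F(A)$. ''$P(A)$ has a solution'' means such $R,C$ exist. Diagonals: the $i$-th diagonal of a square array of size $n$ is $D_i=\{(i+t-1,t): t=1,\dots,n\}$, with row indices modulo $n$. An array of size $n\ge k$ is $k$-diagonal if its filled cells are exactly the cells of $k$ distinct diagonals. It is cyclically $k$-diagonal (with $n>k$) if, in addition, the filled diagonals are consecutive modulo $n$, i.e. $D_i,D_{i+1},\dots,D_{i+k-1}$ for some $i$. *)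

(* Defs.v *)
From mathcomp Require Import all_boot all_order all_algebra all_fingroup.

Set Implicit Arguments.
Unset Strict Implicit.
Unset Printing Implicit Defensive.

(* An n x n array is recorded by its filled (true) / empty (false) pattern.
   Rows and columns are numbered from 0 to n - 1 instead of 1 to n. *)
Definition array (n : nat) := 'M[bool]_n.

Definition filled n (A : array n) : {set 'I_n * 'I_n} := [set x | A x.1 x.2].

(* i + m modulo n *)
Definition shift n (i : 'I_n) (m : nat) : 'I_n := iter m (@ordS n) i.

Lemma val_shift n (i : 'I_n) m : shift i m = (i + m) %% n :> nat.
Proof.
rewrite /shift; elim: m => [|m IHm] /=; first by rewrite addn0 modn_small.
by rewrite IHm -addn1 modnDml addn1 addnS.
Qed.

Lemma shift_inj n m : injective (fun i : 'I_n => shift i m).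
Proof. by elim: m => [|m IHm] i j //= /ordS_inj /IHm. Qed.

Lemma shiftD n (i : 'I_n) m p : shift (shift i m) p = shift i (m + p).
Proof. by rewrite /shift addnC iterD. Qed.

Lemma shift_size n (i : 'I_n) : shift i n = i.
Proof. by apply: val_inj; rewrite /= val_shift modnDr modn_small. Qed.

(* The minimal m >= 1 such that P (i + m); it is at most n when P i holds. *)
Definition gap n (P : pred 'I_n) (i : 'I_n) : nat :=
  (find (fun m => P (shift i m.+1)) (iota 0 n)).+1.

(* Indices outside P are fixed, so that the successor is a permutation. *)
Definition next_in n (P : pred 'I_n) (i : 'I_n) : 'I_n :=
  if P i then shift i (gap P i) else i.

Lemma gapP n (P : pred 'I_n) (i : 'I_n) : P i ->
  [/\ 0 < gap P i, P (shift i (gap P i)) &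
      forall m, 0 < m -> P (shift i m) -> gap P i <= m].
Proof.
move=> Pi; have n_gt0 : 0 < n by apply: leq_ltn_trans (ltn_ord i).
set Q := fun m => P (shift i m.+1).
have hasQ : has Q (iota 0 n).
  apply/hasP; exists n.-1; first by rewrite mem_iota ltn_predL.
  by rewrite /Q prednK // shift_size.
have lt_n : find Q (iota 0 n) < n by rewrite -[ltnRHS](size_iota 0) -has_find.
split=> //; first by have := nth_find 0 hasQ; rewrite nth_iota.
case=> [|m] // _ Pm; rewrite /gap ltnS leqNgt; apply/negP => lt_m.
have := before_find 0 lt_m.
by rewrite nth_iota ?(ltn_trans lt_m) // add0n /Q Pm.
Qed.

Lemma next_in_inj n (P : pred 'I_n) : injective (next_in P).
Proof.
move=> i j; rewrite /next_in.
case: ifP => [Pi|nPi]; case: ifP => [Pj|nPj] //; first 1 last.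
- by move=> eq_ij; case: (gapP Pi) => _; rewrite eq_ij nPj.
- by move=> eq_ij; case: (gapP Pj) => _; rewrite -eq_ij nPi.
wlog le_ij : i j Pi Pj / gap P i <= gap P j => [IH|].
  case/orP: (leq_total (gap P i) (gap P j)) => le_ij; first exact: IH.
  by move/esym/IH => ->.
rewrite -(subnK le_ij) -shiftD => /shift_inj eq_i.
have [eq_d | d_gt0] := posnP (gap P j - gap P i); first by rewrite eq_i eq_d.
have [i_gt0 _ _] := gapP Pi; have [_ _ /(_ _ d_gt0)] := gapP Pj.
by rewrite -eq_i => /(_ Pi); rewrite leqNgt -subn_gt0 subKn // i_gt0.
Qed.

Section Successors.

Variables (n : nat) (A : array n).

Definition row_succ_fun (x : 'I_n * 'I_n) : 'I_n * 'I_n :=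
  (x.1, next_in (fun j => (x.1, j) \in filled A) x.2).

Definition col_succ_fun (x : 'I_n * 'I_n) : 'I_n * 'I_n :=
  (next_in (fun i => (i, x.2) \in filled A) x.1, x.2).

Lemma row_succ_inj : injective row_succ_fun.
Proof. by move=> [i j] [i' j'] [/= <- /next_in_inj ->]. Qed.

Lemma col_succ_inj : injective col_succ_fun.
Proof. by move=> [i j] [i' j'] [/= + eq_j]; rewrite -eq_j => /next_in_inj ->. Qed.

(* Both fix every empty cell; only their restriction to F(A) is meaningful. *)
Definition row_succ : {perm 'I_n * 'I_n} := perm row_succ_inj.
Definition col_succ : {perm 'I_n * 'I_n} := perm col_succ_inj.

End Successors.

Definition perm_expz (T : finType) (s : {perm T}) (e : int) : {perm T} :=
  match e with
  | Posz m => (s ^+ m)%g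
  | Negz m => (s ^- m.+1)%g
  end.

Definition move_fun n (A : array n) (R C : {ffun 'I_n -> int})
    (x : 'I_n * 'I_n) : 'I_n * 'I_n :=
  let y := perm_expz (row_succ A) (R x.1) x in
  perm_expz (col_succ A) (C y.2) y.

Definition sign_vector n (R : {ffun 'I_n -> int}) : Prop :=
  forall i, R i = 1%R \/ R i = (-1)%R.

Definition single_cycle_on (T : finType) (f : T -> T) (D : {set T}) : Prop :=
  exists2 p : seq T, ufcycle f p & p =i D.

Definition is_solution n (A : array n) (R C : {ffun 'I_n -> int}) : Prop :=
  [/\ sign_vector R, sign_vector C & single_cycle_on (move_fun A R C) (filled A)].

Definition has_solution n (A : array n) : Prop :=
  exists R C : {ffun 'I_n -> int}, is_solution A R C.

(* Numbered from 0 like rows and columns: diagonal i here is D_(i+1). *)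
Definition diagonal n (i : 'I_n) : {set 'I_n * 'I_n} :=
  [set (shift i t, t) | t : 'I_n].

Definition k_diagonal n (k : nat) (A : array n) : Prop :=
  exists2 I : {set 'I_n}, #|I| = k & filled A = \bigcup_(i in I) diagonal i.

Definition cyclically_diagonal n (k : nat) (A : array n) : Prop :=
  [/\ k < n, k_diagonal k A &
      exists i : 'I_n, filled A = \bigcup_(m < k) diagonal (shift i m)].

(* Main.v *)
Require Import Defs.
From mathcomp Require Import all_boot all_order all_algebra all_fingroup.
From mathcomp Require Import zify.

(* Necessity is a parity argument: reversing some rows or columns multiplies the row and
   column successors by squares, and reflection in the antidiagonal conjugates the row
   successor to the inverse of the column successor.  So a move permutation is even,
   while a cycle on the nk filled cells is even only if nk is odd.

   For sufficiency let d = k - 1 and g = gcd(n, d), take all rows forward, and reverse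
   exactly the columns of a set E.  Number the filled diagonals by m mod k.  A move
   from diagonal m > 0 goes to the next column, a move from diagonal 0 goes back d
   columns, and diagonal m changes to m - 2 exactly when the new column is in E.
   Since k is odd, the tour visits the columns of E on diagonal 0 by iterating
   x |-> (d-th successor in E of the first return of x to E under translation by -d).
   Translation by -d has the classes modulo g as its orbits, so on a class meeting E in
   one or two points the first return does not depend on n, and on a class with three
   points it is one of the two 3-cycles.  It remains to find, for each even d < 199 and
   odd g dividing d, a set E meeting every class for which this map is a single cycle:
   an interval {0, ..., g + t - 1} with 1 <= t <= 4 does, except when g = 3 and d is one
   of seven values. *)

Set Implicit Arguments.
Unset Strict Implicit.
Unset Printing Implicit Defensive.

Lemma iter_inj (T : Type) (f : T -> T) q : injective f -> injective (iter q f).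
Proof. by move=> f_inj; elim: q => //= q IHq x y /f_inj/IHq. Qed.

Section FirstReturn.

Variables (T : finType) (f : T -> T) (P : pred T).

Definition return_time x := (find P (fingraph.orbit f (f x))).+1.

(* Only meaningful when the orbit of [x] meets [P]. *)
Definition first_return x := iter (return_time x) f x.

Lemma before_first_return x q : 0 < q < return_time x -> ~~ P (iter q f x).
Proof.
case: q => // q /= lt_q; have := before_find (f x) lt_q.
rewrite nth_traject -?iterSr => [->//|].
by have := find_size P (fingraph.orbit f (f x)); rewrite size_orbit; apply: leq_trans.
Qed.

Lemma first_returnP x y :
  injective f -> fconnect f x y -> P y -> P (first_return x).
Proof.
move=> f_inj; rewrite (same_fconnect1 f_inj) fconnect_orbit => x_y Py.
have P_x : has P (fingraph.orbit f (f x)) by apply/hasP; exists y.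
have := nth_find (f x) P_x; rewrite nth_traject -?iterSr //.
by rewrite -[ltnRHS](size_orbit f) -has_find.
Qed.

Lemma first_return_eq x q :
    injective f -> 0 < q -> P (iter q f x) ->
    (forall p, 0 < p < q -> ~~ P (iter p f x)) ->
  first_return x = iter q f x.
Proof.
move=> f_inj q_gt0 Pq minP; rewrite /first_return; congr (iter _ f x).
have Pr := first_returnP f_inj (fconnect_iter f q x) Pq.
case: (ltngtP (return_time x) q) => // lt_q; last first.
  by have := @before_first_return x q; rewrite q_gt0 lt_q Pq => /(_ isT).
by have /negP[] := minP (return_time x) lt_q.
Qed.

Lemma first_return_inj : injective f -> {in P &, injective first_return}.
Proof.
move=> f_inj x y; wlog le_xy : x y / return_time x <= return_time y => [IH|] Px Py.
  case/orP: (leq_total (return_time x) (return_time y)) => /IH le_xy; first exact: le_xy.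
  by move=> /esym/le_xy->.
rewrite /first_return -(subnKC le_xy) iterD => /(iter_inj f_inj) xE.
have [eq_t|gt_t] := posnP (return_time y - return_time x); first by rewrite xE eq_t.
have /before_first_return/negP[] : 0 < return_time y - return_time x < return_time y.
  by rewrite gt_t ltn_subrL.
by rewrite -xE.
Qed.

Lemma first_return_fixed x y :
  P y -> fconnect f x y -> first_return x = x -> y = x.
Proof.
move=> Py /iter_findex; move: (findex f x y) => q yE fix_x.
elim/ltn_ind: q yE => q IHq yE; have [lt_q|le_q] := ltnP q (return_time x).
  case: q yE {IHq} lt_q => // q yE lt_q.
  by have /negP[] := @before_first_return x q.+1 lt_q; rewrite yE.
apply: (IHq (q - return_time x)); first by rewrite ltn_subrL /= (leq_trans _ le_q).
by rewrite -yE -{2}(subnK le_q) iterD -/(first_return x) fix_x.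
Qed.

Lemma fconnect_first_return (U : finType) (F : U -> U) (c c' : T -> U) x :
    (forall y, F (c y) = if P (f y) then c' (f y) else c (f y)) ->
    P (first_return x) ->
  fconnect F (c x) (c' (first_return x)).
Proof.
move=> FcE; have := @before_first_return x; rewrite /first_return /return_time.
move: (find P (fingraph.orbit f (f x))) => q.
elim: q x => [|q IHq] x noP Pq.
  by have := fconnect1 F (c x); rewrite FcE Pq.
apply: connect_trans (fconnect1 _ _) _.
rewrite FcE (negPf (noP 1 isT)) iterSr; apply: IHq; last by rewrite -iterSr.
by move=> p /andP[_ lt_p]; rewrite -iterSr (noP p.+1 lt_p).
Qed.

End FirstReturn.

Lemma gcdn_subr m n : m <= n -> gcdn n (n - m) = gcdn n m.
Proof. by move=> /subnK {1 3}<-; rewrite gcdnC gcdnDl [RHS]gcdnC gcdnDr gcdnC. Qed.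

Section Shift.

Variable n : nat.
Implicit Types (i j : 'I_n) (p q u : nat).

Lemma shiftC i j : shift i j = shift j i.
Proof. by apply: ord_inj; rewrite !val_shift addnC. Qed.

Lemma shift_rev i p : shift (rev_ord (shift i p)) p = rev_ord i.
Proof.
elim: p i => [|p IHp] i //; have -> : shift i p.+1 = shift (shift i p) 1 by [].
rewrite -[RHS]IHp -(add1n p) -shiftD; congr (shift _ p); move: (shift i p) => {}i.
apply: ord_inj; rewrite val_shift /=; have lt_i := ltn_ord i.
have [eq_n|neq_n] := eqVneq i.+1 n; last by rewrite !modn_small; lia.
by rewrite eq_n modnn subnn subn1 addn1 prednK ?modnn //; lia.
Qed.

Lemma iter_shift i u q : iter q (fun j => shift j u) i = shift i (q * u).
Proof. by elim: q => //= q ->; rewrite shiftD mulSn addnC. Qed.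

Lemma fconnect_shift i j u :
  fconnect (fun i' => shift i' u) i j = (i == j %[mod gcdn n u]).
Proof.
have n_gt0 : 0 < n := leq_ltn_trans (leq0n i) (ltn_ord i).
apply/idP/eqP => [/iter_findex <-|eq_ij].
  rewrite iter_shift val_shift modn_dvdm ?dvdn_gcdl // -modnDmr.
  by rewrite (eqP (dvdn_mull _ (dvdn_gcdr n u))) addn0.
have [a _ dvd_a] := Bezoutl u n_gt0.
have dvd_ij : gcdn n u %| i + (n - j).
  rewrite /dvdn -modnDml eq_ij modnDml subnKC ?(ltnW (ltn_ord j)) //.
  exact: dvdn_gcdl.
set w := (i + (n - j)) %/ gcdn n u.
suff <- : shift i (w * a * u) = j by rewrite -iter_shift fconnect_iter.
apply: val_inj; rewrite /= val_shift -[RHS](modn_small (ltn_ord j)); apply/eqP.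
rewrite -(eqn_modDl (w * gcdn n u)) addnCA -mulnA -mulnDr divnK //.
rewrite -modnDmr (eqP (dvdn_mull _ dvd_a)) addn0 -addnA subnK ?modnDr //.
exact: ltnW.
Qed.

End Shift.

Lemma next_in_eq n (P : pred 'I_n) (i : 'I_n) g :
    P i -> 0 < g -> P (shift i g) ->
    (forall q, 0 < q < g -> ~~ P (shift i q)) ->
  next_in P i = shift i g.
Proof.
move=> Pi g_gt0 Pg minP; rewrite /next_in Pi; congr (shift i _).
have [gap_gt0 Pgap /(_ g g_gt0 Pg)] := gapP Pi.
rewrite leq_eqVlt => /predU1P[//|lt_gap].
by have /negP[] := minP (gap P i) (introT andP (conj gap_gt0 lt_gap)).
Qed.

Lemma eq_single_cycle_on (T : finType) (f h : T -> T) (D : {set T}) :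
  f =1 h -> single_cycle_on f D -> single_cycle_on h D.
Proof.
by move=> eq_fh [p cyc_p eq_p]; exists p; rewrite // /ucycle /ucycleb -(eq_fcycle eq_fh).
Qed.

Section Parity.

Variable T : finType.
Implicit Types (s : {perm T}) (D : {set T}) (x : T).

Lemma porbit_fconnect s x : porbit s x =i fconnect s x.
Proof.
move=> y; apply/porbitP/idP => [[q ->]|/iter_findex <-].
  by rewrite permX; apply: fconnect_iter.
by exists (findex s x y); rewrite permX.
Qed.

Lemma porbit_fixed s x : s x = x -> porbit s x = [set x].
Proof.
move=> sx; apply/setP=> y; rewrite porbit_fconnect inE.
by rewrite [LHS](@fconnect_cycle _ _ [:: x]) ?inE //= sx eqxx.
Qed.

Lemma single_cycle_on_porbit s D x :
  x \in D -> single_cycle_on s D <-> porbit s x = D.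
Proof.
move=> xD; split=> [[p /andP[cyc_p _] eq_p]|<-].
  apply/setP=> y; rewrite porbit_fconnect -eq_p.
  by apply: (fconnect_cycle cyc_p); rewrite eq_p.
exists (fingraph.orbit s x); last by move=> y; rewrite porbit_fconnect -fconnect_orbit.
by rewrite /ucycle /ucycleb orbit_uniq cycle_orbit //; apply: perm_inj.
Qed.

Lemma porbit_sub_perm_on s D x : x \in D -> perm_on D s -> porbit s x \subset D.
Proof.
move=> xD onD; apply/subsetP=> y /porbitP[q ->].
by elim: q => [|q IHq]; rewrite ?perm1 // expgSr permM perm_closed.
Qed.

(* One orbit together with [#|~: D|] fixed points. *)
Lemma odd_perm_on_porbit s D x :
  x \in D -> perm_on D s -> porbit s x = D -> odd_perm s = ~~ odd #|D|.
Proof.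
move=> xD onD orbD; rewrite /odd_perm.
have porbitC y : y \notin D -> porbit s y = [set y].
  by move=> yD; rewrite porbit_fixed // (out_perm onD).
have -> : porbits s = D |: [set [set y] | y in ~: D].
  apply/setP=> B; rewrite in_setU1; apply/imsetP/predU1P => [[y _ ->]|].
    have [yD|yD] := boolP (y \in D); last by right; rewrite porbitC // imset_f ?inE.
    by left; rewrite -orbD; apply/eqP; rewrite eq_porbit_mem orbD.
  case=> [->|/imsetP[y]]; first by exists x.
  by rewrite inE => yD ->; exists y; rewrite ?porbitC.
rewrite cardsU1 card_imset; last exact: set1_inj.
have -> : D \notin [set [set y] | y in ~: D].
  by apply/imsetP => -[y + eqD]; rewrite inE eqD set11.
by rewrite -(cardsC D) !oddD; case: (odd _) (odd _) => -[].
Qed.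

Definition reverse_on D s : {perm T} := (s * restr_perm D s ^- 2)%g.

Lemma reverse_onE D s x : (forall y, (s y \in D) = (y \in D)) ->
  reverse_on D s x = if x \in D then (s^-1)%g x else s x.
Proof.
move=> sD; have s_acts : s \in 'N(D | 'P)%g.
  by apply/astabsP => y; apply: sD.
have restrE y : restr_perm D s y = if y \in D then s y else y.
  case: ifP => [yD|/negbT yD]; first exact: restr_permE.
  exact: out_perm (restr_perm_on D s) yD.
have sVD y : ((s^-1)%g y \in D) = (y \in D) by rewrite -sD permKV.
rewrite permM; apply: (@perm_inj _ (restr_perm D s ^+ 2)%g); rewrite permKV.
rewrite expgS expg1 permM !restrE.
by have [xD|/negPf xD] := boolP (x \in D); rewrite /= ?(sVD, permKV, sD, xD).
Qed.

Lemma odd_reverse_on D s : odd_perm (reverse_on D s) = odd_perm s.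
Proof. by rewrite odd_permM odd_permV expgS expg1 odd_permM addbb addbF. Qed.

Lemma reverse_on_perm_on D F s :
  (forall y, (s y \in D) = (y \in D)) -> perm_on F s -> perm_on F (reverse_on D s).
Proof.
move=> sD onF; apply/subsetP=> x; apply: contraR => xF; rewrite reverse_onE //.
by case: ifP => _; apply/eqP; rewrite (out_perm _ xF) // perm_onV.
Qed.

End Parity.

Section CyclicNext.

Variable T : eqType.
Implicit Types (c : seq T) (f : T -> T) (x y : T).

Lemma next_nth_uniq x0 c i :
  uniq c -> i < size c -> next c (nth x0 c i) = nth x0 c (i.+1 %% size c).
Proof.
move=> uniq_c lt_i; rewrite next_nth mem_nth // index_uniq //.
case: c uniq_c lt_i => // x c _ /=; rewrite ltnS leq_eqVlt => /predU1P[->|lt_i].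
  by rewrite modnn nth_default.
by rewrite modn_small //=; apply: set_nth_default.
Qed.

Definition turn (forward : bool) c x := if forward then next c x else prev c x.

Lemma eq_turn_le2 b b' c : uniq c -> size c <= 2 -> {in c, turn b c =1 turn b' c}.
Proof.
move=> uniq_c le2; suff eq_np : {in c, next c =1 prev c}.
  by case: b b' => -[] // x xc; rewrite /turn eq_np.
case: c uniq_c le2 => [|x [|y []]] //= uniq_c _ z.
rewrite !inE andbT in uniq_c *.
by move=> /orP[]/eqP->; rewrite !eqxx ?(eq_sym y) (negPf uniq_c).
Qed.

Lemma turn_of_fixfree_le3 c f : uniq c -> size c <= 3 ->
    {in c, forall x, f x \in c} -> {in c &, injective f} ->
    {in c &, forall x y, f x = x -> y = x} ->
  exists b, {in c, f =1 turn b c}.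
Proof.
move=> uniq_c le3 fc f_inj fix_f.
have f_neq x y : x \in c -> y \in c -> x != y -> f x != x.
  by move=> xc yc; apply: contraNneq => /(fix_f x y xc yc)->.
have ff_neq x y : x \in c -> y \in c -> x != y -> f x != f y.
  by move=> xc yc; apply: contraNneq => /(f_inj x y xc yc)->.
case: c uniq_c le3 fc {f_inj fix_f} f_neq ff_neq => [|x [|y [|z []]]] //=.
- by exists true.
- move=> _ _ fc _ _; exists true => w /[dup]/fc.
  by rewrite !inE /= => /eqP-> /eqP->; rewrite eqxx.
- rewrite !inE andbT => xy _ fc f_neq _.
  have [xc yc] : x \in [:: x; y] /\ y \in [:: x; y] by rewrite !inE !eqxx orbT.
  have yx : y != x by rewrite eq_sym.
  move: (fc x xc) (fc y yc) (f_neq x y xc yc xy) (f_neq y x yc xc yx); rewrite !inE.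
  move=> /orP[]/eqP fx /orP[]/eqP fy; rewrite fx fy ?eqxx // => _ _; exists true => w.
  by rewrite !inE /turn /= => /orP[]/eqP->; rewrite ?fx ?fy ?eqxx ?(negPf yx).
rewrite !inE negb_or andbT => /andP[/andP[xy xz] yz] _ fc f_neq ff_neq.
have [yx zx zy] : [/\ y != x, z != x & z != y] by rewrite !(eq_sym z) eq_sym.
have [xc yc zc] : [/\ x \in [:: x; y; z], y \in [:: x; y; z] & z \in [:: x; y; z]].
  by rewrite !inE !eqxx !orbT.
move: (f_neq x y xc yc xy) (f_neq y x yc xc yx) (f_neq z x zc xc zx).
move: (ff_neq x y xc yc xy) (ff_neq x z xc zc xz) (ff_neq y z yc zc yz).
move: (fc x xc) (fc y yc) (fc z zc); rewrite !inE.
by move=> /or3P[]/eqP fx /or3P[]/eqP fy /or3P[]/eqP fz;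
  rewrite fx fy fz ?eqxx // => _ _ _ _ _ _; [exists true | exists false] => w;
  rewrite !inE /turn /= => /or3P[]/eqP->; rewrite ?fx ?fy ?fz ?eqxx;
  rewrite ?(negPf yx) ?(negPf zx) ?(negPf zy) ?(negPf xy) ?(negPf xz).
Qed.

End CyclicNext.

Definition residue_class g (E : seq nat) x := [seq y <- E | y == x %[mod g]].

Definition turn_class b g E x := turn b (residue_class g E x) x.

Lemma mem_residue_class g E x y :
  (y \in residue_class g E x) = (y == x %[mod g]) && (y \in E).
Proof. exact: mem_filter. Qed.

Lemma eq_residue_class g E x y :
  x = y %[mod g] -> residue_class g E x = residue_class g E y.
Proof. by move=> eq_xy; apply: eq_filter => w; rewrite eq_xy. Qed.

(* A class of at most two points can be turned either way, so the direction is decided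
   by the class of 0 alone. *)
Lemma turn_class_of_fixfree g E (sg : nat -> nat) :
    uniq E -> 0 \in E -> {in E, forall x, size (residue_class g E x) <= 2 + (g %| x)} ->
    {in E, forall x, sg x \in residue_class g E x} -> {in E &, injective sg} ->
    {in E &, forall x y, y = x %[mod g] -> sg x = x -> y = x} ->
  exists b, {in E, sg =1 turn_class b g E}.
Proof.
move=> uniqE memE0 sizeE sgE sg_inj sg_fix.
have turn_on x : x \in E ->
    exists b, {in residue_class g E x, sg =1 turn b (residue_class g E x)}.
  move=> xE; apply: turn_of_fixfree_le3; first by rewrite filter_uniq.
  - by apply: leq_trans (sizeE x xE) _; case: (g %| x).
  - move=> y; rewrite mem_residue_class => /andP[/eqP eq_yx yE].
    by rewrite -(eq_residue_class E eq_yx) sgE.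
  - by move=> y w; rewrite !mem_residue_class => /andP[_ yE] /andP[_ wE]; apply: sg_inj.
  move=> y w; rewrite !mem_residue_class => /andP[/eqP eq_yx yE] /andP[/eqP eq_wx wE].
  by apply: sg_fix => //; rewrite eq_yx.
have [b sg0] := turn_on 0 memE0; exists b => x xE.
have x_class : x \in residue_class g E x by rewrite mem_residue_class eqxx.
rewrite /turn_class; have [dvd_x|/negPf ndvd_x] := boolP (g %| x).
  have eq_x0 : x = 0 %[mod g] by rewrite mod0n; apply/eqP.
  by move: x_class; rewrite (eq_residue_class E eq_x0); apply: sg0.
have := sizeE x xE; have [b' sgx] := turn_on x xE; rewrite ndvd_x sgx // => le2.
by apply: eq_turn_le2; rewrite ?filter_uniq.
Qed.

(* Closed form of [iter d (next E)], much cheaper to compute. *)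
Definition advance (E : seq nat) d x := nth 0 E ((index x E + d) %% size E).

Lemma iter_next E d x : uniq E -> x \in E -> iter d (next E) x = advance E d x.
Proof.
move=> uniqE xE; rewrite /advance; elim: d => [|d IHd] /=.
  by rewrite addn0 modn_small ?index_mem ?nth_index.
have lt_E y : y %% size E < size E by rewrite ltn_mod; case: (E) xE.
by rewrite IHd next_nth_uniq // -addn1 modnDml addn1 addnS.
Qed.

Lemma ltn_index (E : seq nat) :
  sorted ltn E -> {in E &, {mono index^~ E : x y / x < y}}.
Proof.
move=> sortedE x y xE yE; rewrite -{2}(nth_index 0 xE) -{2}(nth_index 0 yE).
by apply/esym/(Order.POrderTheory.lt_sorted_ltn_nth 0 sortedE); rewrite inE index_mem.
Qed.

Lemma sorted_next_gap (E : seq nat) x y : sorted ltn E -> x \in E -> y \in E ->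
  if x < next E x then (y <= x) || (next E x <= y) else next E x <= y <= x.
Proof.
move=> sortedE xE yE; have nE : next E x \in E by rewrite mem_next.
have uniqE : uniq E := sorted_uniq ltn_trans ltnn sortedE.
have next_idx : index (next E x) E = (index x E).+1 %% size E.
  rewrite -{1}(nth_index 0 xE) next_nth_uniq ?index_mem // index_uniq // ltn_mod.
  by case: (E) xE.
have idxE := ltn_index sortedE.
rewrite !(leqNgt _ y) (leqNgt y) -(idxE x) // -(idxE x y) // -(idxE y) // next_idx.
move: xE yE; rewrite -!index_mem; move: (index x E) (index y E) (size E) => i i' s.
rewrite [i < s]leq_eqVlt => /predU1P[<- le_i'|lt_i _].
  by rewrite modnn !ltn0 /= -leqNgt.
by rewrite modn_small // ltnSn -!leqNgt; case: (leqP i' i).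
Qed.

Definition sweep g d E b x := advance E d (turn_class b g E x).

(* Only the class of 0 may meet [E] three times.  The last clause says that the sweep
   started at 0 covers [E], whichever way that class is turned. *)
Definition good_columns g d (E : seq nat) :=
  [&& 0 \in E, sorted ltn E, all (leq^~ d) E,
      all (fun r => residue_class g E r != [::]) (iota 0 g),
      all (fun x => size (residue_class g E x) <= 2 + (g %| x)) E
    & all (fun b => all (mem (traject (sweep g d E b) 0 (size E))) E) [:: true; false]].

(* The last three sets were found by search, for [g = 3]. *)
Definition candidate_columns g : seq (seq nat) :=
  [seq iota 0 (g + t) | t <- iota 1 4] ++
  [:: [:: 0; 1; 2; 5; 6]; [:: 0; 1; 2; 3; 5; 6; 7]; [:: 0; 3; 4; 7; 8; 11; 12]].

Lemma has_good_columns d g : 0 < d < 199 -> ~~ odd d -> odd g -> g %| d ->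
  has (good_columns g d) (candidate_columns g).
Proof.
move=> d_bnd even_d odd_g dvd_gd; have [d_gt0 _] := andP d_bnd.
have lt_gd : g < d.
  by rewrite ltn_neqAle dvdn_leq // andbT; apply: contraNneq even_d => <-.
(* Unlike [has], [find] is evaluated only up to the first success. *)
rewrite has_find; have covered : all (fun d => all (fun g =>
    find (good_columns g d) (candidate_columns g) < size (candidate_columns g))
      [seq g <- iota 0 d | odd g && (g %| d)])
  [seq d <- iota 1 198 | ~~ odd d] by vm_compute.
move/allP/(_ d): covered; rewrite mem_filter mem_iota even_d => /(_ d_bnd).
by move/allP/(_ g); rewrite mem_filter mem_iota odd_g dvd_gd; apply.
Qed.

Definition in_columns n (E : seq nat) : pred 'I_n := fun j => (j : nat) \in E.

Definition shift_return n (E : seq nat) u : 'I_n -> 'I_n :=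
  first_return (fun j => shift j u) (in_columns E).

Lemma shift_return_mod n (E : seq nat) u (j : 'I_n) :
  shift_return E u j = j %[mod gcdn n u].
Proof. by apply/esym/eqP; rewrite -fconnect_shift fconnect_iter. Qed.

(* The gap from the last element of [E] back to the first one wraps around modulo [n]. *)
Lemma shift_return_next n (E : seq nat) (j : 'I_n) :
    sorted ltn E -> {in E, forall x, x < n} -> in_columns E j ->
  shift_return E 1 j = next E j :> nat.
Proof.
move=> sortedE ltE jE; have next_lt : next E j < n by apply: ltE; rewrite mem_next.
have j_lt := ltn_ord j.
pose g := if j < next E j then next E j - j else n - j + next E j.
have [g_gt0 g_le_n] : 0 < g /\ g <= n.
  by rewrite /g; case: (ltnP j (next E j)) => ?; lia.
have jgE : (j + g) %% n = next E j.
  rewrite /g; case: ifP => [/ltnW lt_j|_]; first by rewrite subnKC // modn_small.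
  by rewrite addnA subnKC ?modnDl ?modn_small // ltnW.
rewrite /shift_return (@first_return_eq _ _ _ j g) ?iter_shift ?muln1 ?val_shift //.
- exact: shift_inj.
- by rewrite /in_columns val_shift jgE mem_next.
move=> q /andP[q_gt0 lt_q]; rewrite /in_columns iter_shift muln1 val_shift.
apply/negP => qE; have := sorted_next_gap sortedE jE qE; move: (ltE _ qE).
have lt_qn := leq_trans lt_q g_le_n; move: lt_q; rewrite /g.
have [lt_jq|ge_jq] := ltnP (j + q) n.
  by rewrite modn_small //; case: (ltnP j (next E j)) => ?; lia.
have -> : (j + q) %% n = j + q - n by rewrite -{1}(subnK ge_jq) modnDr modn_small; lia.
by case: (ltnP j (next E j)) => ?; lia.
Qed.

Lemma shift_return_turn n (E : seq nat) u :
    uniq E -> 0 \in E -> {in E, forall x, x < n} ->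
    {in E, forall x, size (residue_class (gcdn n u) E x) <= 2 + (gcdn n u %| x)} ->
    (forall j : 'I_n, in_columns E (shift_return E u j)) ->
  exists b, forall j : 'I_n,
    in_columns E j -> shift_return E u j = turn_class b (gcdn n u) E j :> nat.
Proof.
move=> uniqE memE0 ltE sizeE retE.
pose col x : 'I_n := insubd (Ordinal (ltE 0 memE0)) x.
have colE x : x \in E -> col x = x :> nat by move=> xE; apply/insubdK/ltE.
have col_in x : x \in E -> in_columns E (col x).
  by rewrite /in_columns => xE; rewrite colE.
have [] := @turn_class_of_fixfree _ E (shift_return E u \o col) uniqE memE0 sizeE.
- move=> x xE; rewrite mem_residue_class /= shift_return_mod colE // eqxx.
  exact: retE.
- move=> x y xE yE /ord_inj eq_ret; rewrite -(colE x xE) -(colE y yE); congr nat_of_ord.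
  exact: first_return_inj (@shift_inj n u) _ _ (col_in x xE) (col_in y yE) eq_ret.
- move=> x y xE yE /= eq_yx fix_x; rewrite -(colE x xE) -(colE y yE); congr nat_of_ord.
  have conn_xy : fconnect (fun j => shift j u) (col x) (col y).
    by rewrite fconnect_shift !colE // eq_yx.
  apply: first_return_fixed (col_in y yE) conn_xy _.
  by apply: ord_inj; rewrite [LHS]fix_x colE.
move=> b turnE; exists b => j jE; rewrite -turnE //=.
by congr (nat_of_ord (shift_return E u _)); apply: ord_inj; rewrite colE.
Qed.

Section ColumnLoop.

Variables (n u d : nat) (E : seq nat).
Hypotheses (lt_dn : d < n) (goodE : good_columns (gcdn n u) d E).

Let memE0 : 0 \in E. Proof. by have /andP[] := goodE. Qed.
Let sortedE : sorted ltn E. Proof. by have /and3P[] := goodE. Qed.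
Let uniqE : uniq E := sorted_uniq ltn_trans ltnn sortedE.
Let ltE : {in E, forall x, x < n}.
Proof.
move=> x xE; have /and4P[_ _ /allP/(_ x xE) le_xd _] := goodE.
exact: leq_ltn_trans lt_dn.
Qed.

Definition column_loop (j : 'I_n) : 'I_n :=
  iter d (shift_return E 1) (shift_return E u j).

Lemma shift_return_in v (j : 'I_n) :
  gcdn n v %| gcdn n u -> in_columns E (shift_return E v j).
Proof.
move=> dvd_vu; have /and4P[_ _ _ /andP[/allP/(_ (j %% gcdn n u)) class_j _]] := goodE.
have : residue_class (gcdn n u) E (j %% gcdn n u) != [::].
  by apply: class_j; rewrite mem_iota ltn_mod gcdn_gt0 (leq_ltn_trans _ (ltn_ord j)).
rewrite -has_filter => /hasP[x xE]; rewrite modn_mod => /eqP eq_xj.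
pose j' := Ordinal (ltE xE); have j'E : in_columns E j' by [].
apply: first_returnP (@shift_inj n v) _ j'E.
by rewrite fconnect_shift -(modn_dvdm j dvd_vu) -eq_xj modn_dvdm.
Qed.

Lemma shift_return1_in (j : 'I_n) : in_columns E (shift_return E 1 j).
Proof. by apply: shift_return_in; rewrite gcdn1. Qed.

Lemma iter_shift_return1_in q (j : 'I_n) :
  in_columns E j -> in_columns E (iter q (shift_return E 1) j).
Proof. by case: q => // q _; apply: shift_return1_in. Qed.

Lemma column_loop_in j : in_columns E (column_loop j).
Proof. by apply: iter_shift_return1_in; apply: shift_return_in. Qed.

Lemma iter_shift_return1 q (j : 'I_n) :
  in_columns E j -> iter q (shift_return E 1) j = advance E q j :> nat.
Proof.
move=> jE; rewrite -iter_next //; elim: q => //= q <-.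
by apply: shift_return_next => //; apply: iter_shift_return1_in.
Qed.

Lemma column_loop_sweep :
  exists b, forall j, in_columns E j -> column_loop j = sweep (gcdn n u) d E b j :> nat.
Proof.
have /and5P[_ _ _ _ /andP[/allP sizeE _]] := goodE.
have [|b turnE] := shift_return_turn uniqE memE0 ltE sizeE.
  by move=> j; apply: shift_return_in.
by exists b => j jE; rewrite iter_shift_return1 ?shift_return_in // turnE.
Qed.

Lemma column_loop_covers (j0 j : 'I_n) :
  j0 = 0 :> nat -> in_columns E j -> exists q, iter q column_loop j0 = j.
Proof.
move=> j0_eq0 jE; have [b loopE] := column_loop_sweep.
have /and5P[_ _ _ _ /and3P[_ sweep_true /andP[sweep_false _]]] := goodE.
have : (j : nat) \in traject (sweep (gcdn n u) d E b) 0 (size E).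
  by case: (b); [move/allP: sweep_true | move/allP: sweep_false]; apply.
case/trajectP=> q _ jq; exists q; apply: ord_inj; rewrite jq; elim: q {jq} => //= q IHq.
rewrite loopE ?IHq // /in_columns.
by case: q {IHq} => [|q]; [rewrite /= j0_eq0 | apply: column_loop_in].
Qed.

End ColumnLoop.

Section Moves.

Variables (n : nat) (A : array n) (R C : {ffun 'I_n -> int}).

Lemma row_succ_row x : (row_succ A x).1 = x.1.
Proof. by rewrite permE. Qed.

Lemma col_succ_col x : (col_succ A x).2 = x.2.
Proof. by rewrite permE. Qed.

Lemma row_succ_perm_on : perm_on (filled A) (row_succ A).
Proof.
apply/subsetP=> -[i j]; apply: contraR => /negPf ijF.
by rewrite permE /row_succ_fun /next_in /= ijF.
Qed.

Lemma col_succ_perm_on : perm_on (filled A) (col_succ A).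
Proof.
apply/subsetP=> -[i j]; apply: contraR => /negPf ijF.
by rewrite permE /col_succ_fun /next_in /= ijF.
Qed.

Let reversed_rows := [set x : 'I_n * 'I_n | R x.1 == (-1)%R].
Let reversed_cols := [set x : 'I_n * 'I_n | C x.2 == (-1)%R].

Let row_succ_reversed x : (row_succ A x \in reversed_rows) = (x \in reversed_rows).
Proof. by rewrite !inE row_succ_row. Qed.

Let col_succ_reversed x : (col_succ A x \in reversed_cols) = (x \in reversed_cols).
Proof. by rewrite !inE col_succ_col. Qed.

Definition move_perm : {perm 'I_n * 'I_n} :=
  (reverse_on reversed_rows (row_succ A) * reverse_on reversed_cols (col_succ A))%g.

Lemma move_permE x : move_perm x =
  let y := if R x.1 == (-1)%R then ((row_succ A)^-1)%g x else row_succ A x in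
  if C y.2 == (-1)%R then ((col_succ A)^-1)%g y else col_succ A y.
Proof. by rewrite permM !reverse_onE // !inE. Qed.

Lemma move_perm_fun : sign_vector R -> sign_vector C -> move_perm =1 move_fun A R C.
Proof.
move=> signR signC x; rewrite move_permE /move_fun /=.
have expzE (s : {perm 'I_n * 'I_n}) e y : e = 1%R \/ e = (-1)%R ->
    perm_expz s e y = if e == (-1)%R then (s^-1)%g y else s y.
  by case=> ->; rewrite /= expg1.
by rewrite !expzE.
Qed.

Lemma odd_move_perm :
  odd_perm move_perm = odd_perm (row_succ A) (+) odd_perm (col_succ A).
Proof. by rewrite odd_permM !odd_reverse_on. Qed.

Lemma move_perm_on : perm_on (filled A) move_perm.
Proof.
apply: perm_onM; apply: reverse_on_perm_on => //.
  exact: row_succ_perm_on.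
exact: col_succ_perm_on.
Qed.

End Moves.

Section Cells.

Variables (n k : nat) (A : array n) (a : 'I_n).
Hypotheses (k_gt0 : 0 < k) (lt_kn : k < n).
Hypothesis filledE : filled A = \bigcup_(m < k) diagonal (shift a m).

Definition cell m (j : 'I_n) : 'I_n * 'I_n := (shift (shift a m) j, j).

Lemma cell_row m j p : (shift (cell m j).1 p, j) = cell (m + p) j.
Proof. by rewrite /cell !shiftD addnAC. Qed.

Lemma eq_cell m m' j j' : (cell m j == cell m' j') = (m == m' %[mod n]) && (j == j').
Proof.
rewrite xpair_eqE andbC [RHS]andbC; case: eqP => //= <-.
by rewrite -val_eqE /= !shiftD !val_shift !addnA eqn_modDr eqn_modDl.
Qed.

Lemma cell_eqmod m m' j : m = m' %[mod n] -> cell m j = cell m' j.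
Proof. by move=> eq_m; apply/eqP; rewrite eq_cell eq_m !eqxx. Qed.

Lemma cell_shift m p j : cell m (shift j p) = ((cell (m + p) j).1, shift j p).
Proof.
congr (_, _); apply: ord_inj; rewrite /= !shiftD !val_shift.
by rewrite addnA modnDmr -!addnA (addnC p).
Qed.

Lemma filledP x : reflect (exists2 m, m < k & exists j, x = cell m j) (x \in filled A).
Proof.
rewrite filledE; apply: (iffP bigcupP) => [[m _ /imsetP[j _ ->]]|[m lt_m [j ->]]].
  by exists m => //; exists j.
by exists (Ordinal lt_m) => //; apply: imset_f.
Qed.

Lemma cell_filled m j : (cell m j \in filled A) = (m %% n < k).
Proof.
apply/filledP/idP => [[m' lt_m' [j' /eqP]]|lt_m].
  by rewrite eq_cell => /andP[/eqP->]; rewrite modn_small // (ltn_trans lt_m').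
by exists (m %% n) => //; exists j; apply: cell_eqmod; rewrite modn_mod.
Qed.

Lemma card_filled : #|filled A| = n * k.
Proof.
have -> : filled A = [set cell mj.1 mj.2 | mj : 'I_k * 'I_n].
  apply/setP=> x; apply/filledP/imsetP => [[m lt_m [j ->]]|[[m j] _ ->]].
    by exists (Ordinal lt_m, j).
  by exists m => //; exists j.
rewrite card_imset ?card_prod ?card_ord 1?mulnC // => -[m j] [m' j'] /= /eqP.
rewrite eq_cell !modn_small ?(ltn_trans _ lt_kn) //.
by move=> /andP[/eqP/ord_inj-> /eqP->].
Qed.

(* The distance from a filled diagonal to the next one, cyclically. *)
Definition skip m := if m.+1 < k then 1 else n - m.

Lemma skipP m : m < k ->
  [/\ 0 < skip m, (m + skip m) %% n < k &
      forall p, 0 < p < skip m -> k <= (m + p) %% n].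
Proof.
move=> lt_m; rewrite /skip; case: (ltnP m.+1 k) => [lt_m1|ge_m1].
  split=> //; last by case=> [|[]].
  by rewrite addn1 modn_small // (ltn_trans lt_m1).
split=> [||p lt_p].
- by rewrite subn_gt0 (ltn_trans lt_m).
- by rewrite subnKC ?modnn //; lia.
- by rewrite modn_small; lia.
Qed.

Lemma col_succ_cell m j : m < k -> col_succ A (cell m j) = cell (m + skip m) j.
Proof.
move=> lt_m; have [skip_gt0 lt_skip no_filled] := skipP lt_m.
have m_mod : m %% n = m by rewrite modn_small // (ltn_trans lt_m).
rewrite permE /col_succ_fun.
rewrite (@next_in_eq _ _ _ (skip m)) ?cell_row ?cell_filled ?m_mod //.
by move=> p /no_filled; rewrite cell_row cell_filled -leqNgt.
Qed.

Lemma row_succ_cell m j : m < k ->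
  row_succ A (cell (m + skip m) j) = cell m (shift j (skip m)).
Proof.
move=> lt_m; have [skip_gt0 lt_skip no_filled] := skipP lt_m.
have m_mod : m %% n = m by rewrite modn_small // (ltn_trans lt_m).
have rowE p : p <= skip m ->
    ((cell (m + skip m) j).1, shift j p) = cell (m + (skip m - p)) (shift j p).
  by move=> le_p; rewrite cell_shift -addnA subnK.
rewrite permE /row_succ_fun (@next_in_eq _ _ _ (skip m)) //.
- by rewrite rowE // subnn addn0.
- by rewrite cell_filled.
- by rewrite rowE // cell_filled subnn addn0 m_mod.
move=> p /andP[p_gt0 lt_p]; rewrite rowE 1?ltnW // cell_filled -leqNgt.
by apply: no_filled; rewrite subn_gt0 lt_p ltn_subrL p_gt0.
Qed.

Definition antitranspose (x : 'I_n * 'I_n) := (rev_ord x.2, rev_ord x.1).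

Lemma antitransposeK : involutive antitranspose.
Proof. by case=> i j; rewrite /antitranspose /= !rev_ordK. Qed.

Lemma antitranspose_cell m j :
  antitranspose (cell m j) = cell m (rev_ord (cell m j).1).
Proof.
have rowE : (cell m j).1 = shift j (shift a m) by apply: shiftC.
by congr (_, _); rewrite [RHS]shiftC rowE shift_rev.
Qed.

Lemma row_succ_antitranspose x :
  row_succ A (antitranspose (col_succ A x)) = antitranspose x.
Proof.
have [/filledP[m lt_m [j ->]]|xF] := boolP (x \in filled A).
  rewrite col_succ_cell // !antitranspose_cell row_succ_cell // -cell_row /=.
  by rewrite shift_rev.
rewrite (out_perm (col_succ_perm_on A)) // (out_perm (row_succ_perm_on A)) //.
apply: contra xF => /filledP[m lt_m [j /(congr1 antitranspose)]].
rewrite antitransposeK antitranspose_cell => ->.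
by rewrite cell_filled modn_small // (ltn_trans lt_m).
Qed.

Lemma odd_row_col_succ : odd_perm (row_succ A) = odd_perm (col_succ A).
Proof.
pose t := perm (inv_inj antitransposeK).
have tE x : t x = antitranspose x by rewrite permE.
suff -> : row_succ A = ((col_succ A)^-1 ^ t)%g by rewrite odd_permJ odd_permV.
apply/permP => x; rewrite -[x](permKV t) permJ -[(t^-1 x)%g](permKV (col_succ A)).
by rewrite permK !tE row_succ_antitranspose.
Qed.

Lemma has_solution_odd : has_solution A -> odd n /\ odd k.
Proof.
move=> [R [C [signR signC cycle_move]]]; apply/andP; rewrite -oddM -card_filled.
have j0 : 'I_n := a; have cF : cell 0 j0 \in filled A by rewrite cell_filled mod0n.
have moveE := move_perm_fun A signR signC.
have orbF : porbit (move_perm A R C) (cell 0 j0) = filled A.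
  by apply/single_cycle_on_porbit => //; apply: eq_single_cycle_on cycle_move => x.
have := odd_perm_on_porbit cF (move_perm_on A R C) orbF.
by rewrite odd_move_perm odd_row_col_succ addbb => /esym/negbFE.
Qed.

Section Tour.

Variable E : seq nat.
Hypotheses (odd_k : odd k) (k_gt2 : 2 < k).
Hypothesis goodE : good_columns (gcdn n (n - k.-1)) k.-1 E.

Definition tour_rows : {ffun 'I_n -> int} := [ffun=> 1%R].
Definition tour_cols : {ffun 'I_n -> int} :=
  [ffun j => if in_columns E j then (-1)%R else 1%R].

Lemma tour_rows_sign : sign_vector tour_rows.
Proof. by move=> i; rewrite ffunE; left. Qed.

Lemma tour_cols_sign : sign_vector tour_cols.
Proof. by move=> j; rewrite ffunE; case: ifP; [right | left]. Qed.

Definition tour := move_perm A tour_rows tour_cols.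

Lemma tour_cell m m' j : m < k -> m' < k -> m' + skip m' = m %[mod n] ->
  tour (cell (m + skip m) j) =
    if in_columns E (shift j (skip m)) then cell m' (shift j (skip m))
    else cell (m + skip m) (shift j (skip m)).
Proof.
move=> lt_m lt_m' eq_m; rewrite move_permE ffunE /= row_succ_cell // ffunE /=.
case: (in_columns _ _) => /=; last by rewrite col_succ_cell.
by rewrite -(cell_eqmod _ eq_m) -col_succ_cell // permK.
Qed.

Lemma skip_inner m : m.+1 < k -> skip m = 1.
Proof. by rewrite /skip => ->. Qed.

Lemma skip_last : skip k.-1 = n - k.-1.
Proof. by rewrite /skip prednK // ltnn. Qed.

Lemma gcdn_skip m : m < k -> gcdn n (skip m) %| gcdn n (n - k.-1).
Proof.
move=> lt_m; have [lt_m1|ge_m1] := ltnP m.+1 k.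
  by rewrite skip_inner // gcdn1 dvd1n.
have -> : m = k.-1 by lia.
by rewrite skip_last.
Qed.

Lemma tour_return m m' j : m < k -> m' < k -> m' + skip m' = m %[mod n] ->
  fconnect tour (cell (m + skip m) j) (cell m' (shift_return E (skip m) j)).
Proof.
move=> lt_m lt_m' eq_m; apply: fconnect_first_return => [i|]; first exact: tour_cell.
by apply: (shift_return_in _ goodE); [lia | exact: gcdn_skip].
Qed.

Lemma tour_down2 m j : m.+2 < k ->
  fconnect tour (cell m.+2 j) (cell m (shift_return E 1 j)).
Proof.
move=> lt_m; have := @tour_return m.+1 m j; rewrite !skip_inner ?addn1; [|lia..].
by apply=> //; lia.
Qed.

Lemma tour_cell1 j : fconnect tour (cell 1 j) (cell k.-1 (shift_return E 1 j)).
Proof.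
have := @tour_return 0 k.-1 j; rewrite (@skip_inner 0) ?skip_last ?add0n //; last by lia.
by apply=> //; rewrite ?subnKC ?modnn ?mod0n //; lia.
Qed.

Lemma tour_cell0 j : fconnect tour (cell 0 j) (cell k.-2 (shift_return E (n - k.-1) j)).
Proof.
have := @tour_return k.-1 k.-2 j; rewrite skip_last skip_inner; last by lia.
rewrite (@cell_eqmod (k.-1 + (n - k.-1)) 0); last by rewrite subnKC ?modnn ?mod0n //; lia.
by apply; rewrite ?addn1; [lia | lia | congr (_ %% n); lia].
Qed.

Lemma tour_even b j : b.*2 < k ->
  fconnect tour (cell b.*2 j) (cell 0 (iter b (shift_return E 1) j)).
Proof.
elim: b j => [|b IHb] j lt_b //; rewrite iterSr doubleS in lt_b *.
by apply: connect_trans (tour_down2 j lt_b) (IHb _ _); lia.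
Qed.

Lemma tour_odd b j : b.*2.+1 < k ->
  fconnect tour (cell b.*2.+1 j) (cell 0 (iter (k./2 + b.+1) (shift_return E 1) j)).
Proof.
have k_half : k.-1 = k./2.*2 by rewrite -[k in LHS]odd_double_half odd_k.
elim: b j => [|b IHb] j lt_b; rewrite addnS iterSr.
  by apply: connect_trans (tour_cell1 j) _; rewrite addn0 k_half; apply: tour_even; lia.
by rewrite doubleS in lt_b *; apply: connect_trans (tour_down2 j lt_b) (IHb _ _); lia.
Qed.

Let loop : 'I_n -> 'I_n := column_loop (n - k.-1) k.-1 E.

Lemma tour_column_loop j : fconnect tour (cell 0 j) (cell 0 (loop j)).
Proof.
have k_half : k = k./2.*2.+1 by rewrite -[LHS]odd_double_half odd_k.
have k2E : k.-2 = (k./2.-1).*2.+1 by lia.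
apply: connect_trans (tour_cell0 j) _; rewrite k2E /loop /column_loop.
have k1E : k.-1 = k./2 + (k./2.-1).+1 by lia.
by rewrite [X in iter X _ _]k1E; apply: tour_odd; lia.
Qed.

Lemma tour_to_diagonal0 m j : m < k ->
  exists j', fconnect tour (cell m j) (cell 0 j').
Proof.
by rewrite -(odd_double_half m); case: (odd m) => [/tour_odd|/tour_even] conn_j;
  eexists; apply: conn_j.
Qed.

Lemma tour_connected (j0 : 'I_n) x :
  j0 = 0 :> nat -> x \in filled A -> fconnect tour (cell 0 j0) x.
Proof.
move=> j0_eq0 /filledP[m lt_m [j ->]]; have [j' conn_j'] := tour_to_diagonal0 j lt_m.
have lt_pred_kn : k.-1 < n by lia.
have loop_in := column_loop_in lt_pred_kn goodE j'.
have [q loop_q] := column_loop_covers lt_pred_kn goodE j0_eq0 loop_in.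
apply: (@connect_trans _ _ (cell 0 (loop j'))).
  rewrite /loop -loop_q; elim: q {loop_q} => [|q IHq] //=.
  exact: connect_trans IHq (tour_column_loop _).
rewrite fconnect_sym; last exact: perm_inj.
exact: connect_trans conn_j' (tour_column_loop j').
Qed.

Lemma has_solution_of_good_columns : has_solution A.
Proof.
exists tour_rows, tour_cols; split; [exact: tour_rows_sign | exact: tour_cols_sign |].
apply: eq_single_cycle_on (move_perm_fun A tour_rows_sign tour_cols_sign) _.
pose j0 : 'I_n := Ordinal (ltn_trans k_gt0 lt_kn).
have cellF : cell 0 j0 \in filled A by rewrite cell_filled mod0n.
apply/(single_cycle_on_porbit _ cellF)/eqP; rewrite eqEsubset.
rewrite (porbit_sub_perm_on cellF) ?move_perm_on //=.
by apply/subsetP => x /(tour_connected (erefl : j0 = 0 :> nat)); rewrite porbit_fconnect.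
Qed.

End Tour.

End Cells.

Theorem theorem4p11 (k n : nat) (A : array n)
    (hk : 3 <= k < 200) (hn : k < n) (hA : cyclically_diagonal k A) :
  has_solution A <-> odd n /\ odd k.
Proof.
have [_ _ [a filledE]] := hA; have /andP[k_gt2 k_lt] := hk.
have k_gt0 : 0 < k by apply: leq_trans k_gt2.
split=> [|[odd_n odd_k]]; first exact: has_solution_odd k_gt0 hn filledE.
pose g := gcdn n k.-1.
have /hasP[E _ goodE] : has (good_columns g k.-1) (candidate_columns g).
  apply: has_good_columns; first by lia.
  - by move: odd_k; rewrite -{1}(prednK k_gt0).
  - exact: dvdn_odd (dvdn_gcdl _ _) odd_n.
  exact: dvdn_gcdr.
apply: (has_solution_of_good_columns k_gt0 hn filledE odd_k k_gt2 (E := E)).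
by rewrite gcdn_subr //; lia.
Qed.
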